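(* Let $m>n\ge1$ and $q,\alpha,\beta\ge1$ be integers with $\gcd(\alpha,\beta)=1$, let $p=\gcd(m,n)$, and let $C(n,q\alpha)\in\{a<z\}^n$ and $C(m,q\beta)\in\{b<z\}^m$ be two superimposable Christoffel words. Let $(x,y)$ be the solution in positive integers of $$x\alpha+y\beta=p-2\alpha\beta(q-1)$$ such that $y\le\alpha$. Then the number of superimpositions of $C(n,q\alpha)$ and $C(m,q\beta)$ is (i) $xy\,\dfrac mp$, if $x\le\beta$; (ii) $(x\alpha+y\beta-\alpha\beta)\,\dfrac mp$, if $x>\beta$.
   Context: For coprime $s,t\in\{0,1,2,\dots\}$ and $n=s+t$, the Christoffel word over the ordered alphabet $\{a<z\}$ with $s$ occurrences of $a$ and $t$ occurrences of $z$ is $u=u[0]u[1]\cdots u[n-1]$ with $u[i]=a$ if $((i+1)t \bmod n)>(it\bmod n)$ and $u[i]=z$ otherwise. It is denoted $C(n,s)$; calling $C(n,s)$ a Christoffel word presupposes $\gcd(n,s)=1$. Over $\{b<z\}$ the definition is the same with $b$ in place of $a$. For a letter $c$ and a finite word $w$, $\gamma(cw)=wc$; $\gamma$ is a bijection on words of a given length, and $\gamma^k$ is defined for all $k\in\mathbb Z$. Let $u\in\{a,z\}^n$ and $v\in\{b,z\}^m$, let $A$ be the set of positions (indexed from $0$) of the letter $a$ in $u$ and $B$ the set of positions of the letter $b$ in $v$. The words $u,v$ are perfectly superimposable if $(A+n\mathbb Z)\cap(B+m\mathbb Z)=\emptyset$, and superimposable if there is $k\in\mathbb Z$ with $(A+n\mathbb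 Z)\cap(B-k+m\mathbb Z)=\emptyset$ (equivalently, $u$ and $\gamma^k(v)$ are perfectly superimposable for some $k$). For superimposable Christoffel words $C(n,s)$ and $C(m,t)$ with $m>n$, the number of superimpositions is the number of $k\in\{0,1,\dots,m-1\}$ such that $C(n,s)$ and $\gamma^kC(m,t)$ are perfectly superimposable. *)

(* Defs.v *)
From mathcomp Require Import all_boot all_order all_algebra.
From mathcomp Require Import boolp classical_sets.

Set Implicit Arguments.
Unset Strict Implicit.
Unset Printing Implicit Defensive.

Local Open Scope classical_set_scope.

Inductive letter := La | Lb | Lz.

(* The Christoffel word over the ordered alphabet {c < Lz}, where [c] is
   intended to be [La] or [Lb]; meaningful when [s <= n] and [coprime n s]. *)
Definition christoffel (c : letter) (n s : nat) : seq letter :=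
  mkseq (fun i => if (i.+1 * (n - s) %% n > i * (n - s) %% n)%N
                  then c else Lz) n.

(* gamma (c w) = w c *)
Definition gamma (w : seq letter) : seq letter := rot 1 w.

Definition positions (c : letter) (w : seq letter) : set nat :=
  [set i | (i < size w)%N /\ nth Lz w i = c].

(* A + n Z, where A is the set of positions of [c] in [w] and n = |w|. *)
Definition periodic_positions (c : letter) (w : seq letter) : set int :=
  [set (Posz i + k * Posz (size w))%R | i in positions c w & k in [set: int]].

Definition perfectly_superimposable (u v : seq letter) : Prop :=
  periodic_positions La u `&` periodic_positions Lb v = set0.

Definition superimposable (u v : seq letter) : Prop :=
  exists k : int,
    periodic_positions La u `&`
      [set (j - k)%R | j in periodic_positions Lb v] = set0.

Definition nb_superimpositions (u v : seq letter) : nat :=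
  #|[pred k : 'I_(size v) |
      `[< perfectly_superimposable u (iter k gamma v) >]]|.

(* Main.v *)
(* Multiplying positions by q alpha beta turns the occurrences of a and of b,
   reduced mod p, into arithmetic progressions of q alpha terms with step
   -beta and q beta terms with step -alpha. By the Chinese remainder theorem,
   whether a shift is a superimposition only depends on its class mod p, and
   up to an affine bijection of Z/p the bad shifts are the residues of
   beta i + alpha j with i < q alpha and j < q beta. These integers are
   written uniquely as beta i + alpha j + alpha beta l with i < alpha,
   j < beta, l <= 2q - 2, and since p = x alpha + y beta + (2q - 2) alpha beta
   the coincidences mod p are generated by those of (i, j, 2q - 2) with
   (i - y, j - x, 0).
   Hence there are (2q - 1) alpha beta - (alpha - y) max(beta - x, 0) bad
   classes. *)
Require Import Defs.
From mathcomp Require Import boolp classical_sets.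
From mathcomp Require Import all_boot all_order all_algebra.
From mathcomp Require Import zify ring.

Set Implicit Arguments.
Unset Strict Implicit.
Unset Printing Implicit Defensive.

Import GRing.Theory.

(** * Natural numbers modulo p *)

Lemma Zp_nat_eq p a b : 1 < p ->
  ((a%:R == b%:R :> 'Z_p)%R) = (a == b %[mod p]).
Proof. by move=> p1; rewrite -val_eqE /= !val_Zp_nat. Qed.

Lemma Zp_nat_eq0 p a : 1 < p -> ((a%:R == 0 :> 'Z_p)%R) = (p %| a).
Proof. by move=> p1; rewrite (Zp_nat_eq a 0 p1) mod0n. Qed.

(** Each of the [d] blocks of [p] consecutive integers runs once through Z/p. *)
Lemma count_Zp_period p d (P : pred 'Z_p) : 1 < p ->
  count (fun k => P (k%:R)%R) (iota 0 (d * p)) = d * #|P|.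
Proof.
move=> p1; elim: d => [|d IHd] //.
rewrite mulSnr iotaD count_cat IHd add0n -[in iota _ p](addn0 (d * p)) iotaDl.
rewrite count_map mulSnr; congr (_ + _).
have -> : iota 0 p = map val (enum 'Z_p) by rewrite val_enum_ord Zp_cast.
rewrite count_map cardE enumT /enum_mem size_filter -enumT.
apply: eq_count => z /=.
by rewrite natrD natrM [(p%:R)%R]pchar_Zp // mulr0 add0r natr_Zp.
Qed.

Lemma eqn_mod_mul2l d k a b : coprime d k ->
  k * a = k * b %[mod d] -> a = b %[mod d].
Proof.
move=> dk; wlog ab : a b / a <= b.
  by move=> W kab; have [|/ltnW] := leqP a b => ab; [|apply/esym]; exact: W.
move/esym/eqP; rewrite eqn_mod_dvd ?leq_mul2l ?ab ?orbT // -mulnBr.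
by rewrite Gauss_dvdr // -eqn_mod_dvd // => /eqP/esym.
Qed.

(** * Positions of a letter in a Christoffel word *)

Lemma size_christoffel c n s : size (christoffel c n s) = n.
Proof. exact: size_mkseq. Qed.

(** Adding n - s to a remainder r wraps around modulo n exactly when r >= s, so the rise that
    defines the letter [c] means r < s. *)
Lemma nth_christoffel c n s i : c <> Lz -> 0 < s < n -> i < n ->
  nth Lz (christoffel c n s) i = c <-> i * (n - s) %% n < s.
Proof.
move=> cz /andP[s0 sn] i_n; rewrite nth_mkseq // mulSnr.
have r_n : i * (n - s) %% n < n by rewrite ltn_mod; lia.
rewrite -modnDml; move: (_ %% n) r_n => r r_n.
have [rs|sr] := ltnP r s.
  by rewrite modn_small ?ifT //; lia.
have -> : r + (n - s) = n + (r - s) by lia.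
rewrite modnDl modn_small; last lia.
by rewrite ifF; [split=> [/esym|]|lia].
Qed.

(** Modulo n, i(n - s) is -is, so [c] occurs at i when is + r = 0 for some r < s; this passes to
    Z/p. Conversely, solving for i in Z/n lifts the solution z, since s is invertible modulo n and
    modulo p. *)
Lemma christoffel_residueP c n s p (z : 'Z_p) :
  c <> Lz -> 0 < s < n -> coprime n s -> 1 < p -> p %| n ->
  (exists2 i, positions c (christoffel c n s) i & (i%:R = z)%R) <->
  (exists2 r, r < s & (z * s%:R + r%:R = 0)%R).
Proof.
move=> cz sn cns p1 pn; have n1 : 1 < n by lia.
have ps_unit : ((s%:R : 'Z_p) \is a GRing.unit)%R.
  by rewrite unitZpE // (coprime_dvdl pn).
have key i : n %| i * s + i * (n - s) %% n.
  rewrite /dvdn modnDmr -mulnDr subnKC; last lia.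
  by rewrite modnMl.
split=> [[i [+ ni] <-]|[r rs zr]].
  rewrite size_christoffel => i_n; exists (i * (n - s) %% n).
    exact/(nth_christoffel cz sn i_n).
  by apply/eqP; rewrite -natrM -natrD Zp_nat_eq0 // (dvdn_trans pn).
have ns_unit : ((s%:R : 'Z_n) \is a GRing.unit)%R by rewrite unitZpE.
pose w : 'Z_n := (- r%:R / s%:R)%R.
have wn : w < n by rewrite -[X in _ < X](Zp_cast n1).
have nw : n %| w * s + r.
  by rewrite -Zp_nat_eq0 // natrD natrM natr_Zp mulrVK // addNr.
exists (w : nat).
  split; first by rewrite size_christoffel.
  apply/nth_christoffel => //.
  have /eqP := key w; have /eqP := nw.
  rewrite -!/(_ == _) => nw0 kw0.
  have : r == w * (n - s) %% n %[mod n].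
    by rewrite -(eqn_modDl (w * s)) kw0 nw0.
  by rewrite modn_mod modn_small; [move/eqP <-|lia].
apply: (mulIr ps_unit); apply: (addIr (r%:R)%R); rewrite zr.
by apply/eqP; rewrite -natrM -natrD Zp_nat_eq0 // (dvdn_trans pn).
Qed.

(** * Superimposition as a condition modulo p *)

Lemma iter_gamma k w : k <= size w -> iter k gamma w = rot k w.
Proof.
elim: k => [|k IHk] kw; first by rewrite rot0.
by rewrite iterS IHk 1?ltnW // /gamma -rotS.
Qed.

Lemma nth_rot_mod (T : Type) (x0 : T) k (w : seq T) i :
  k <= size w -> i < size w ->
  nth x0 (rot k w) i = nth x0 w ((i + k) %% size w).
Proof.
move=> kw iw; rewrite /rot nth_cat size_drop.
have [ik|ki] := ltnP i (size w - k).
  by rewrite nth_drop addnC modn_small //; lia.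
have -> : i + k = size w + (i - (size w - k)) by lia.
by rewrite nth_take ?modnDl ?modn_small //; lia.
Qed.

Lemma perfectly_superimposableP u v k p :
  p = gcdn (size v) (size u) -> 1 < p -> k < size v ->
  perfectly_superimposable u (iter k gamma v) <->
  ~ exists i j, [/\ positions La u i, positions Lb v j &
                    (i%:R + k%:R = j%:R :> 'Z_p)%R].
Proof.
move=> pE p1 kv; rewrite iter_gamma 1?ltnW // /perfectly_superimposable.
have pu : ((size u)%:R = 0 :> 'Z_p)%R.
  by apply/eqP; rewrite Zp_nat_eq0 // pE dvdn_gcdr.
have pv : ((size v)%:R = 0 :> 'Z_p)%R.
  by apply/eqP; rewrite Zp_nat_eq0 // pE dvdn_gcdl.
have modv a : ((a %% size v)%:R = a%:R :> 'Z_p)%R.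
  by rewrite [in RHS](divn_eq a (size v)) natrD natrM pv mulr0 add0r.
split.
- move=> uv0 [i [j [[iu ui] [jv vj] ij]]].
  (* Rotation by [k] moves position j to j - k; adding [size v] first keeps the subtraction in the
     naturals. *)
  pose j' := (j + (size v - k)) %% size v.
  have j'v : j' < size v by rewrite ltn_mod; lia.
  have ij' : (i%:R = j'%:R :> 'Z_p)%R.
    by rewrite modv natrD natrB 1?ltnW // pv sub0r -ij addrK.
  have : (Posz p %| (j'%:Z - i%:Z)%R)%Z.
    rewrite -eqz_mod_dvd !modz_nat eqz_nat.
    by rewrite -Zp_nat_eq // ij'.
  (* From a|v| + b|u| = p and j' - i = ep, the integer i + eb|u| = j' - ea|v| is a common
     position. *)
  have [a [b ab]] := Bezoutz (size v) (size u).
  have -> : Posz p = gcdz (size v) (size u) by rewrite pE.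
  rewrite -ab => /dvdzP[e ee].
  have : (periodic_positions La u `&` periodic_positions Lb (rot k v))%classic
     (i%:Z + (e * b) * (size u)%:Z)%R.
    split; first by exists i => //; exists (e * b)%R.
    exists j'; last first.
      exists (- (e * a))%R => //.
      by rewrite size_rot -[Posz j'](subrK (Posz i)) ee; ring.
    split; first by rewrite size_rot.
    rewrite nth_rot_mod ?(ltnW kv) // /j' modnDml -addnA subnK 1?ltnW //.
    by rewrite modnDr modn_small.
  by rewrite uv0.
- move=> noij; rewrite -classical_sets.subset0.
  move=> z [[i [iu ui] [a _ <-]] [j [jv vj] [b _]]].
  rewrite size_rot in jv *.
  move=> /(congr1 (fun z : int => (z%:~R : 'Z_p)%R)).
  rewrite !rmorphD !rmorphM /= -!pmulrn pu pv !mulr0 !addr0 => ji.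
  apply: noij; exists i, ((j + k) %% size v); split=> //.
    split; first by rewrite ltn_mod; lia.
    by rewrite -nth_rot_mod ?(ltnW kv).
  by rewrite modv natrD -ji.
Qed.

(** * Counting the residues of the box *)

(** Reducing modulo [alpha] and modulo [beta] gives i' = i + c alpha and j' = j + d beta; with l' =
    l + e this leaves alpha beta (c + d + e) = 0. The primed digits carry no upper bound, so they
    may be sums of digits. *)
Lemma mixed_radix_uniq alpha beta i j l i' j' l' :
  coprime alpha beta ->
  i < alpha -> j < beta -> l <= l' ->
  beta * i + alpha * j + alpha * beta * l =
    beta * i' + alpha * j' + alpha * beta * l' ->
  [/\ i = i', j = j' & l = l'].
Proof.
move=> ab ia jb ll' eqv.
have mod_a : i' = i %[mod alpha].
  apply: (eqn_mod_mul2l ab).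
  have := congr1 (modn^~ alpha) eqv.
  rewrite /= -!addnA -!mulnA -!mulnDr ![alpha * _]mulnC.
  by rewrite ![_ + _ * alpha]addnC !modnMDl.
have mod_b : j' = j %[mod beta].
  apply: (@eqn_mod_mul2l _ alpha); first by rewrite coprime_sym.
  have := congr1 (modn^~ beta) eqv.
  rewrite /= ![alpha * beta]mulnC -!addnA ![_ + beta * _ * _]addnC.
  by rewrite -!mulnA !addnA -!mulnDr ![beta * _]mulnC !modnMDl.
have i'E : i' = i' %/ alpha * alpha + i.
  by rewrite {1}(divn_eq i' alpha) mod_a modn_small.
have j'E : j' = j' %/ beta * beta + j.
  by rewrite {1}(divn_eq j' beta) mod_b modn_small.
move: (i' %/ alpha) (j' %/ beta) i'E j'E => c d i'E j'E.
rewrite -(subnKC ll') in eqv *; move: (l' - l) eqv => e; rewrite i'E j'E => eqv.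
have : alpha * beta * (c + d + e) = 0.
  apply: (@addnI (beta * i + alpha * j + alpha * beta * l)).
  rewrite addn0 [in RHS]eqv; ring.
move/eqP; rewrite !muln_eq0 !addn_eq0.
have /gtn_eqF-> : 0 < alpha by lia.
have /gtn_eqF-> : 0 < beta by lia.
by move=> /= /andP[/andP[/eqP-> /eqP->] /eqP->]; rewrite !mul0n addn0.
Qed.

Section BoxResidues.

Variables (p q alpha beta x y : nat).
Hypotheses (q0 : 0 < q) (ab : coprime alpha beta).
Hypotheses (x0 : 0 < x) (y0 : 0 < y) (ya : y <= alpha).
Hypotheses (pE : p = x * alpha + y * beta + alpha * beta * (q.-1).*2).
Hypotheses (p1 : 1 < p).

Let T := ('I_alpha * 'I_beta * 'I_(q.-1).*2.+1)%type.

Let value (t : T) :=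
  let: (i, j, l) := t in beta * i + alpha * j + alpha * beta * l.

Let residue (t : T) : 'Z_p := ((value t)%:R)%R.

(** The triples from which (y, x, 2q - 2) can be subtracted inside the box, which lowers [value] by
    [p]. *)
Let corner : {set T} :=
  [set t : T | let: (i, j, l) := t in
               [&& y <= i, x <= j & l == (q.-1).*2 :> nat]].

Definition box_residues : {set 'Z_p} :=
  [set ((beta * i + alpha * j)%:R)%R | i : 'I_(q * alpha), j : 'I_(q * beta)].

(** Divide i by [alpha] and j by [beta]: both quotients have weight alpha beta, so only their sum l
    matters. *)
Lemma box_residuesE : box_residues = [set residue t | t : T].
Proof.
apply/setP => z; apply/imset2P/imsetP => [[i j _ _ ->]|[[[i j] l] _ ->]].
- have ba : 0 < beta by case: (j) => ? /=; lia.
  have il : i %% alpha < alpha by rewrite ltn_mod; lia.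
  have jl : j %% beta < beta by rewrite ltn_mod; lia.
  have ll : i %/ alpha + j %/ beta < (q.-1).*2.+1.
    have : i %/ alpha < q by rewrite ltn_divLR //; lia.
    have : j %/ beta < q by rewrite ltn_divLR.
    lia.
  exists (Ordinal il, Ordinal jl, Ordinal ll) => //.
  rewrite /residue /value /=; congr (_%:R)%R.
  rewrite {1}(divn_eq i alpha) {1}(divn_eq j beta); ring.
(* Split l <= 2q - 2 into two quotients, each at most q - 1. *)
- pose c := minn l q.-1; pose d := l - c.
  have il : i + c * alpha < q * alpha.
    have : c.+1 * alpha <= q * alpha by rewrite leq_mul2r; lia.
    by have := ltn_ord i; lia.
  have jl : j + d * beta < q * beta.
    have : d.+1 * beta <= q * beta by rewrite leq_mul2r; have := ltn_ord l; lia.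
    by have := ltn_ord j; lia.
  exists (Ordinal il) (Ordinal jl) => //.
  rewrite /residue /value /=; congr (_%:R)%R.
  have -> : nat_of_ord l = c + d by lia.
  ring.
Qed.

(** Infinite descent: a corner triple shares its residue with a triple whose value is smaller by
    [p]. *)
Lemma residue_corner :
  [set residue t | t : T] = [set residue t | t in ~: corner].
Proof.
apply/setP => z; apply/imsetP/imsetP => [[t _ ->]|[t _ ->]]; last by exists t.
have [N] := ubnP (value t).
elim: N t => // N IHN [[i j] l] tN.
have [|tc] := boolP ((i, j, l) \in corner); last first.
  by exists (i, j, l) => //; rewrite inE; exact: tc.
rewrite inE /= => /and3P[yi xj /eqP lE].
have il : i - y < alpha by have := ltn_ord i; lia.
have jl : j - x < beta by have := ltn_ord j; lia.
pose t' : T := (Ordinal il, Ordinal jl, ord0).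
have vE : value (i, j, l) = value t' + p.
  rewrite /value pE /= lE -{1}(subnK yi) -{1}(subnK xj); ring.
have -> : residue (i, j, l) = residue t'.
  by rewrite /residue vE natrD [(p%:R)%R]pchar_Zp // addr0.
by apply: IHN; move: tN; rewrite vE; move: (value t') => w; lia.
Qed.

(** If the values differ by kp with k > 0, the larger triple has digits i' + ky, j' + kx, l' + k(2q
    - 2), which puts it in the corner. *)
Lemma residue_inj : {in ~: corner &, injective residue}.
Proof.
move=> t t'; wlog le_tt' : t t' / value t' <= value t.
  move=> W tc t'c rr; have [le|/ltnW le] := leqP (value t') (value t).
    exact: W.
  by apply/esym/W.
move: t t' le_tt' => [[i j] l] [[i' j'] l'] le_v tc _ /eqP.
rewrite /residue Zp_nat_eq // eqn_mod_dvd // => /dvdnP[k vk].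
have {}vk : value (i, j, l) = value (i', j', l') + k * p by rewrite -vk subnKC.
rewrite /value pE /= in vk.
have {}vk : beta * i + alpha * j + alpha * beta * l =
    beta * (i' + k * y) + alpha * (j' + k * x)
      + alpha * beta * (l' + k * (q.-1).*2).
  rewrite vk; ring.
have [k0|k0] := posnP k.
  move: vk; rewrite k0 !mul0n !addn0.
  have [ll|/ltnW ll] := leqP l l'.
    by move=> /(mixed_radix_uniq ab)[] // /val_inj-> /val_inj-> /val_inj->.
  by move=> /esym/(mixed_radix_uniq ab)[] // /val_inj-> /val_inj-> /val_inj->.
have lL : l <= l' + k * (q.-1).*2 by have := ltn_ord l; nia.
have [iE jE lE] := mixed_radix_uniq ab (ltn_ord i) (ltn_ord j) lL vk.
move: tc; rewrite !inE /= => /negP[]; apply/and3P; split; first nia.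
  nia.
by apply/eqP; have := ltn_ord l; nia.
Qed.

Lemma card_corner : #|corner| = (alpha - y) * (beta - x).
Proof.
have card_geq n k : #|[set i : 'I_n | k <= i]| = n - k.
  rewrite cardsE cardE /enum_mem size_filter -enumT.
  have -> : n - k = count (leq k) (iota 0 n).
    elim: n => // n; rewrite -addn1 iotaD count_cat /= add0n => <-.
    by case: leqP; lia.
  by rewrite -val_enum_ord count_map.
have -> : corner = setX (setX [set i : 'I_alpha | y <= i]
                              [set j : 'I_beta | x <= j]) [set ord_max].
  by apply/setP => -[[i j] l]; rewrite !inE /= andbA.
by rewrite !cardsX cards1 muln1 !card_geq.
Qed.

Lemma card_box_residues :
  #|box_residues| = alpha * beta * (q.-1).*2.+1 - (alpha - y) * (beta - x).
Proof.
rewrite box_residuesE residue_corner card_in_imset; last exact: residue_inj.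
have := cardsC corner; rewrite card_corner !card_prod !card_ord => <-.
by rewrite addKn.
Qed.

End BoxResidues.

(** * From shifts to the box, and the final count *)

(** Eliminating i from i q alpha + r = 0 and (i + k) q beta + r' = 0 gives k q alpha beta = beta r -
    alpha r'. Reflecting r' to q beta - 1 - r' makes both signs positive, at the cost of the
    constant alpha (q beta - 1). *)
Lemma overlap_box m n q alpha beta p k :
  p = gcdn m n -> 1 < p ->
  0 < q * alpha < n -> coprime n (q * alpha) ->
  0 < q * beta < m -> coprime m (q * beta) ->
  (exists i j, [/\ positions La (christoffel La n (q * alpha)) i,
                   positions Lb (christoffel Lb m (q * beta)) j &
                   (i%:R + k%:R = j%:R :> 'Z_p)%R]) <->
  (k%:R * (q * alpha * beta)%:R + (alpha * (q * beta).-1)%:R)%R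
    \in box_residues p q alpha beta.
Proof.
move=> pE p1 sn cns tm cmt.
have [pm pn] : p %| m /\ p %| n by rewrite pE dvdn_gcdl dvdn_gcdr.
have cps := coprime_dvdl pn cns.
have cpt := coprime_dvdl pm cmt.
have s_unit : (((q * alpha)%:R : 'Z_p) \is a GRing.unit)%R by rewrite unitZpE.
have a_unit : ((alpha%:R : 'Z_p) \is a GRing.unit)%R.
  by rewrite unitZpE // (coprime_dvdr _ cps) // dvdn_mull.
have posA z := @christoffel_residueP La n _ p z ltac:(by []) sn cns p1 pn.
have posB z := @christoffel_residueP Lb m _ p z ltac:(by []) tm cmt p1 pm.
split.
- move=> [i [j [iA jB ij]]].
  have [|r rs zr] := (posA (i%:R)%R).1; first by exists i.
  have [|r' rt zr'] := (posB (j%:R)%R).1; first by exists j.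
  have r't : (q * beta).-1 - r' < q * beta by lia.
  apply/imset2P; exists (Ordinal rs) (Ordinal r't) => //=.
  have -> : (q * beta).-1 = r' + ((q * beta).-1 - r') by lia.
  rewrite addKn; move: (_ - _) => w.
  rewrite -ij in zr'; rewrite !natrM !natrD !natrM in zr zr' *.
  move/eqP: zr; rewrite addrC addr_eq0 => /eqP zr.
  move/eqP: zr'; rewrite addrC addr_eq0 => /eqP zr'.
  rewrite zr zr'; ring.
- move=> /imset2P[r r' _ _ /= kE].
  have rs := ltn_ord r; have rt := ltn_ord r'.
  have [_ [|i iA iE]] := posA (- r%:R / (q * alpha)%:R)%R.
    by exists r => //; rewrite mulrVK // addNr.
  have [_ [|j jB jE]] := posB (i%:R + k%:R)%R.
    exists ((q * beta).-1 - r'); first lia.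
    (* The elimination multiplied the second equation by [alpha], which is invertible modulo [p]. *)
    apply: (mulrI a_unit); rewrite mulr0.
    have zr : (i%:R * (q * alpha)%:R + r%:R = 0 :> 'Z_p)%R.
      by rewrite iE mulrVK // addNr.
    have r'E : (q * beta).-1 = r' + ((q * beta).-1 - r') by lia.
    rewrite {1}r'E in kE; move: (_ - _) kE => w kE.
    rewrite !natrM !natrD !natrM in zr kE *.
    move/eqP: zr; rewrite addrC addr_eq0 => /eqP zr.
    move/eqP: kE; rewrite zr mulrDr addrA [X in (_ == X)%R]addrC.
    rewrite [X in (X == _)%R]addrAC -subr_eq0 => /eqP kE.
    rewrite -kE; ring.
  by exists i, j; split=> //; rewrite jE.
Qed.

Lemma nb_superimpositions_count u v p (P : pred 'Z_p) :
  1 < p -> p %| size v ->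
  (forall k, k < size v ->
    perfectly_superimposable u (iter k gamma v) <-> P (k%:R)%R) ->
  nb_superimpositions u v = size v %/ p * #|P|.
Proof.
move=> p1 pv uvP; rewrite -count_Zp_period // divnK // /nb_superimpositions.
rewrite -val_enum_ord count_map cardE enumT /enum_mem size_filter -enumT.
apply: eq_count => k /=.
by apply/asboolP/idP => [/uvP|Pk]; [exact|apply/uvP].
Qed.

Lemma nb_superimpositions_box m n q alpha beta p :
  p = gcdn m n -> 1 < p ->
  0 < q * alpha < n -> coprime n (q * alpha) ->
  0 < q * beta < m -> coprime m (q * beta) ->
  nb_superimpositions (christoffel La n (q * alpha))
                      (christoffel Lb m (q * beta)) =
    (p - #|box_residues p q alpha beta|) * (m %/ p).
Proof.
move=> pE p1 sn cns tm cmt.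
have [pm pn] : p %| m /\ p %| n by rewrite pE dvdn_gcdl dvdn_gcdr.
rewrite (@nb_superimpositions_count _ _ p
  (fun z => (z * (q * alpha * beta)%:R + (alpha * (q * beta).-1)%:R)%R
            \notin box_residues p q alpha beta)) ?size_christoffel //.
  rewrite mulnC; congr (_ * _).
  have a_unit : (((q * alpha * beta)%:R : 'Z_p) \is a GRing.unit)%R.
    rewrite unitZpE // coprimeMr (coprime_dvdl pn cns).
    by rewrite (coprime_dvdr _ (coprime_dvdl pm cmt)) // dvdn_mull.
  (* The affine map permutes Z/p, so the good classes are as many as the residues outside the
     box. *)
  have inj : injective (fun z : 'Z_p =>
      z * (q * alpha * beta)%:R + (alpha * (q * beta).-1)%:R)%R.
    by move=> z z' /addIr/(mulIr a_unit).
  have -> : p - #|box_residues p q alpha beta| =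
      #|~: box_residues p q alpha beta|.
    have := cardsC (box_residues p q alpha beta).
    rewrite [in RHS]card_ord [in RHS]Zp_cast // => cE.
    by rewrite -[X in X - _]cE addKn.
  rewrite -(card_preimset _ inj).
  by apply: eq_card => z; rewrite !inE.
move=> k km; rewrite (@perfectly_superimposableP _ _ _ p) ?size_christoffel //.
by rewrite overlap_box //; split=> [|/negP]; [move/negP|].
Qed.

Theorem proposition4p3 (m n q alpha beta p x y : nat)
  (hn : 1 <= n) (hnm : n < m)
  (hq : 1 <= q) (halpha : 1 <= alpha) (hbeta : 1 <= beta)
  (hab : coprime alpha beta)
  (hp : p = gcdn m n)
  (hsn : q * alpha <= n) (hcn : coprime n (q * alpha))
  (hsm : q * beta <= m) (hcm : coprime m (q * beta))
  (hsup : superimposable (christoffel La n (q * alpha))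
                         (christoffel Lb m (q * beta)))
  (hx : 1 <= x) (hy : 1 <= y)
  (hxy : (x%:Z * alpha%:Z + y%:Z * beta%:Z
            = p%:Z - 2 * alpha%:Z * beta%:Z * (q%:Z - 1))%R)
  (hya : y <= alpha) :
  (x <= beta ->
     nb_superimpositions (christoffel La n (q * alpha))
                         (christoffel Lb m (q * beta))
     = x * y * (m %/ p)) /\
  (beta < x ->
     ((nb_superimpositions (christoffel La n (q * alpha))
                           (christoffel Lb m (q * beta)))%:Z
      = (x%:Z * alpha%:Z + y%:Z * beta%:Z - alpha%:Z * beta%:Z)
          * (m %/ p)%N%:Z)%R).
Proof.
have pE : p = x * alpha + y * beta + alpha * beta * (q.-1).*2.
  case: q hq hxy {hsn hcn hsm hcm hsup} => // q' _; lia.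
(* Both x alpha and y beta are positive. The bound matters because ['Z_p] is Z/p only for p > 1. *)
have p1 : 1 < p.
  have : 0 < x * alpha by rewrite muln_gt0 hx.
  have : 0 < y * beta by rewrite muln_gt0 hy.
  rewrite pE; move: (x * alpha) (y * beta) (alpha * _ * _) => ? ? ?; lia.
have pm : p <= m by rewrite hp dvdn_leq ?dvdn_gcdl //; lia.
have pn : p <= n by rewrite hp dvdn_leq ?dvdn_gcdr.
(* Equality s = N would force N = 1 by coprimality, against 1 < p <= N. *)
have lt_coprime N s : p <= N -> s <= N -> coprime N s -> s < N.
  move=> pN; rewrite leq_eqVlt => /predU1P[->|//].
  by rewrite /coprime gcdnn => /eqP N1; lia.
have sn : 0 < q * alpha < n by rewrite muln_gt0 hq halpha lt_coprime.
have tm : 0 < q * beta < m by rewrite muln_gt0 hq hbeta lt_coprime.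
rewrite (@nb_superimpositions_box _ _ _ _ _ p) //.
rewrite (@card_box_residues _ _ _ _ x y) //.
split=> [xb|bx].
  congr (_ * _); rewrite pE.
  (* With alpha = y + a and beta = x + b, the corner has ab triples and the difference simplifies to
     xy. *)
  have aE := subnKC hya; have bE := subnKC xb.
  move: (alpha - y) (beta - x) aE bE => a b aE bE.
  rewrite -aE -bE mulnS.
  move: ((y + a) * (x + b) * _) => c.
  have -> : (y + a) * (x + b) + c - a * b = c + (y * x + y * b + a * x).
    by rewrite mulnDl !mulnDr; lia.
  have -> : x * (y + a) + y * (x + b) + c =
            x * y + (c + (y * x + y * b + a * x)).
    ring.
  by rewrite addnK.
(* The corner is empty; x > beta also makes the remaining natural subtraction exact. *)
have -> : beta - x = 0 by lia.
rewrite muln0 subn0 PoszM; congr (_ * _)%R.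
rewrite pE; nia.
Qed.
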